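(* Let $p\ge 5$ be prime and let $n\ge 1$ satisfy $n\equiv 2\pmod 4$. Then $v_p(\mathbf G_n(p))\ge 2$. If, in addition, $n\not\equiv 2\pmod{p-1}$, then $v_p(\mathbf G_n(p))\ge 3$.
   Context: Here $i^2=-1$. For an odd prime $p$ and $n\ge 0$, $\mathbf G_n(p)=\sum_{a=1}^{p-1}\sum_{b=1}^{p-1}(a+bi)^n\in\mathbb Z[i]$. For $x+yi\in\mathbb Z[i]$, $v_p(x+yi)=\min\{v_p(x),v_p(y)\}$, where $v_p$ on integers is the usual $p$-adic valuation ($v_p(0)=\infty$). *)

(* Defs.v *)
From HB Require Import structures.
From mathcomp Require Import all_boot all_order all_algebra.
From mathcomp Require Import constructive_ereal complex.

Set Implicit Arguments.
Unset Strict Implicit.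
Unset Printing Implicit Defensive.

Import Order.TTheory GRing.Theory Num.Theory.
Local Open Scope ring_scope.

(* The library gives the carrier [complex R] an additive group structure for
   every ring R, but a ring structure only when R is a field. Z[i] is therefore
   an alias of [complex int], equipped with the library's own [mulc]. *)
Definition gaussInt : Type := complex int.

HB.instance Definition _ := GRing.Zmodule.on gaussInt.

Definition gauss1 : gaussInt := Complex 1 0.

Fact gauss_mul1r : left_id gauss1 (@ComplexField.mulc int).
Proof. by move=> [a b] /=; rewrite !mul1r !mul0r subr0 addr0. Qed.

Fact gauss_mulDl :
  left_distributive (@ComplexField.mulc int) (@GRing.add gaussInt).
Proof.
move=> [a b] [c d] [e f].
rewrite -[LHS]/(Complex ((a + c) * e - (b + d) * f) ((a + c) * f + (b + d) * e)).
by rewrite !mulrDl opprD addrACA [X in Complex _ X]addrACA.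
Qed.

Fact gauss_oner_neq0 : gauss1 != 0.
Proof. by []. Qed.

HB.instance Definition _ := GRing.Zmodule_isComNzRing.Build gaussInt
  (@ComplexField.mulcA int) (@ComplexField.mulcC int)
  gauss_mul1r gauss_mulDl gauss_oner_neq0.

Definition gaussI : gaussInt := Complex 0 1.

Fact sqr_gaussI : gaussI ^+ 2 = -1.
Proof. by []. Qed.

Fact gaussIntE (a b : nat) : a%:R + b%:R * gaussI = Complex a%:Z b%:Z.
Proof.
have natE m : m%:R = Complex m%:Z 0 :> gaussInt.
  elim: m => // m IHm; rewrite mulrS IHm.
  by rewrite -[LHS]/(ComplexField.addc _ _) /= -PoszD add1n.
rewrite !natE -[LHS]/(ComplexField.addc _ (ComplexField.mulc _ _)) /=.
by rewrite !(mulr0, mulr1, mul0r, subr0, addr0, add0r).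
Qed.

Definition gaussPowerSum (n p : nat) : gaussInt :=
  \sum_(1 <= a < p) \sum_(1 <= b < p) (a%:R + b%:R * gaussI) ^+ n.

(* [logn p 0] is 0 by convention, hence the separate infinite value at 0. *)
Definition vpint (p : nat) (m : int) : \bar int :=
  if m == 0 then +oo%E else (logn p `|m|%N)%:Z%:E.

Definition vpgauss (p : nat) (z : gaussInt) : \bar int :=
  Order.min (vpint p (complex.Re z)) (vpint p (complex.Im z)).

(* Main.v *)
Require Import Defs.
From mathcomp Require Import all_boot all_order all_algebra.
From mathcomp Require Import constructive_ereal.
From mathcomp Require Import complex finfield ring.

(** Write [P k] for the sum of the [k]-th powers of the lattice points
    [z = a + b i] of the open square [0 < a, b < p].  The square is stable under
    the quarter turn [z |-> p + i z] and the half turn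
    [z |-> p (1 + i) - z] about its centre.  Expanding the [n]-th powers of the
    images modulo [p ^ 3], and using [i ^ n = -1] and [(-1) ^ n = 1] for [n] congruent to 2 modulo 4, gives
<<
      2 P n = n i p P (n-1) + C(n,2) p^2 P (n-2)             mod p^3
          0 = - n (1+i) p P (n-1) + 2 i C(n,2) p^2 P (n-2)   mod p^3.
>>
    The combination which cancels [P (n-1)] (twice the first relation plus
    [1 + i] times the second) is [4 P n = 2 i C(n,2) p^2 P (n-2)] modulo [p ^ 3]
    ([powerSum_rotation]).  As 4 is prime to [p], this shows at once that [p ^ 2]
    divides [P n], and that [p ^ 3] does as soon as [p] divides [P (n-2)].

    The binomial theorem turns [P m] into a combination of the products
    [S (m-k) * S k], where [S k] is the sum of the [k]-th powers of
    [1, .., p-1].  Since [p] divides [S k] unless [p-1] divides [k]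
    ([dvdn_sum_expn]), [p] divides [P m] unless [p-1] divides [m]
    ([powerSum_dvd]); for [m = n-2] this is the extra hypothesis of the second
    claim. *)

Set Implicit Arguments.
Unset Strict Implicit.
Unset Printing Implicit Defensive.

Import Order.TTheory GRing.Theory Num.Theory.
Local Open Scope ring_scope.

(** * Power sums of the residues modulo a prime *)

(** By Fermat [x ^+ k] depends only on [r = k %% p.-1], and [0 < r < p.-1]:
    ['X^r - 1] cannot vanish at all the [p.-1] nonzero residues, so some [x != 0]
    has [x ^+ k != 1].  Substituting [x * y] for [y] multiplies the sum by
    [x ^+ k] without changing it, so that it is 0. *)
Lemma sum_exp_Fp (p k : nat) : prime p -> ~~ (p.-1 %| k)%N ->
  \sum_(x : 'F_p) x ^+ k = 0.
Proof.
move=> p_pr ndvd.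
have p1_gt0 : (0 < p.-1)%N by rewrite -subn1 subn_gt0 prime_gt1.
have fermat (x : 'F_p) : x != 0 -> x ^+ p.-1 = 1.
  move=> x0; apply: (mulfI x0); rewrite mulr1 -exprS prednK ?prime_gt0 //.
  by have := expf_card x; rewrite card_Fp.
have [x /andP[x0 xk]] : exists x : 'F_p, (x != 0) && (x ^+ k != 1).
  apply/existsP; apply: contraR ndvd => /existsPn all1.
  have xk1 (x : 'F_p) : x != 0 -> x ^+ (k %% p.-1) = 1.
    move=> x0; have := all1 x; rewrite x0 /= negbK => /eqP.
    by rewrite {1}(divn_eq k p.-1) exprD mulnC exprM fermat // expr1n mul1r.
  rewrite /dvdn -leqn0 leqNgt; apply/negP => r_gt0.
  suff : (p.-1 <= k %% p.-1)%N by rewrite leqNgt ltn_pmod.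
  have {1}<- : size (enum (predC1 (0 : 'F_p))) = p.-1.
    by rewrite -cardE cardC1 card_Fp.
  apply: max_unity_roots r_gt0 _ (enum_uniq _).
  apply/allP => x; rewrite mem_enum inE => x0.
  by apply/unity_rootP; exact: xk1.
set s := \sum_x _.
have : x ^+ k * s = s.
  rewrite {2}/s (reindex_inj (mulfI x0)) /= mulr_sumr.
  by apply: eq_bigr => y _; rewrite exprMn.
move/eqP; rewrite -{2}[s]mul1r -subr_eq0 -mulrBl mulf_eq0 subr_eq0 (negPf xk).
by move/eqP.
Qed.

Lemma dvdn_sum_expn (p k : nat) : prime p -> ~~ (p.-1 %| k)%N ->
  (p %| \sum_(1 <= a < p) a ^ k)%N.
Proof.
move=> p_pr ndvd.
have k_gt0 : (0 < k)%N by case: k ndvd => //; rewrite dvdn0.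
rewrite (dvdn_pcharf (pchar_Fp p_pr)) -(sum_exp_Fp p_pr ndvd).
suff -> : (\sum_(1 <= a < p) a ^ k = \sum_(a < (Zp_trunc (pdiv p)).+2) a ^ k)%N.
  rewrite natr_sum; apply/eqP/eq_bigr => x _.
  by rewrite natrX natr_Zp.
(* The residue 0 contributes nothing, as [0 < k]. *)
rewrite -(big_mkord xpredT (expn^~ k)) Fp_cast //.
by rewrite [RHS]big_ltn ?prime_gt0 // exp0n.
Qed.

(** * Rotations of the square *)

Definition modeq (R : comNzRingType) (d x y : R) := exists w, x = y + d * w.

Lemma modeq_sum (R : comNzRingType) (d : R) m n (F G : nat -> R) :
  (forall a, (m <= a < n)%N -> modeq d (F a) (G a)) ->
  modeq d (\sum_(m <= a < n) F a) (\sum_(m <= a < n) G a).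
Proof.
move=> FG; rewrite big_nat_cond [X in modeq _ _ X]big_nat_cond.
apply: (big_ind2 (modeq d)) => [|_ x _ y [v ->] [w ->]|a].
- by exists 0; ring.
- by exists (v + w); ring.
- by rewrite andbT => /FG.
Qed.

Lemma modeq_exprD (R : comNzRingType) (x y d : R) m :
  modeq (d ^+ 3) ((x + d * y) ^+ m.+2)
    (x ^+ m.+2 + m.+2%:R * d * y * x ^+ m.+1
     + 'C(m.+2, 2)%:R * d ^+ 2 * y ^+ 2 * x ^+ m).
Proof.
elim: m => [|m [w IHm]].
  by exists 0; rewrite binn; ring.
exists (w * (x + d * y) + 'C(m.+2, 2)%:R * y ^+ 3 * x ^+ m).
rewrite exprS IHm (binS m.+2) bin1 natrD (mulrS 1 m.+2) !(exprS x); ring.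
Qed.

Definition powerSum (R : comNzRingType) (i : R) (p n : nat) : R :=
  \sum_(1 <= a < p) \sum_(1 <= b < p) (a%:R + b%:R * i) ^+ n.

Lemma sum_sub_rev (R : comNzRingType) p (F : nat -> R) :
  \sum_(1 <= a < p) F a = \sum_(1 <= a < p) F (p - a)%N.
Proof. by rewrite big_nat_rev; apply: eq_bigr => a _; rewrite add1n subSS. Qed.

(** The quarter turn sends [(a, b)] to [(p - b, a)]. *)
Lemma powerSum_quarter_turn (R : comNzRingType) (i : R) p n : i ^+ 2 = -1 ->
  powerSum i p n =
  \sum_(1 <= a < p) \sum_(1 <= b < p) (i * (a%:R + b%:R * i) + p%:R * 1) ^+ n.
Proof.
move=> i2; rewrite /powerSum sum_sub_rev exchange_big /=.
apply: eq_bigr => a _; apply: eq_big_nat => b /andP[_ /ltnW b_le].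
by rewrite natrB // mulrDr mulrCA -expr2 i2; congr (_ ^+ _); ring.
Qed.

(** The half turn sends [(a, b)] to [(p - a, p - b)]. *)
Lemma powerSum_half_turn (R : comNzRingType) (i : R) p n :
  powerSum i p n =
  \sum_(1 <= a < p) \sum_(1 <= b < p)
     (-1 * (a%:R + b%:R * i) + p%:R * (1 + i)) ^+ n.
Proof.
rewrite /powerSum sum_sub_rev; apply: eq_big_nat => a /andP[_ /ltnW a_le].
rewrite sum_sub_rev; apply: eq_big_nat => b /andP[_ /ltnW b_le].
by rewrite !natrB //; congr (_ ^+ _); ring.
Qed.

(** Both turns have the form [z |-> u z + p v]; the expansion is needed modulo
    [p ^ 3] only, hence stops after three terms. *)
Lemma modeq_powerSum_affine (R : comNzRingType) (i u v : R) p m :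
  modeq (p%:R ^+ 3)
    (\sum_(1 <= a < p) \sum_(1 <= b < p)
       (u * (a%:R + b%:R * i) + p%:R * v) ^+ m.+2)
    (u ^+ m.+2 * powerSum i p m.+2
     + m.+2%:R * p%:R * v * u ^+ m.+1 * powerSum i p m.+1
     + 'C(m.+2, 2)%:R * p%:R ^+ 2 * v ^+ 2 * u ^+ m * powerSum i p m).
Proof.
rewrite /powerSum !mulr_sumr -!big_split /=; apply: modeq_sum => a _.
rewrite !mulr_sumr -!big_split /=; apply: modeq_sum => b _.
have := modeq_exprD (u * (a%:R + b%:R * i)) v p%:R m.
by rewrite !exprMn !mulrA.
Qed.

(** The two rotations give two relations between the power sums of exponents
    [m.+2], [m.+1] and [m], from which the sum of exponent [m.+1] is
    eliminated. *)
Lemma powerSum_rotation (R : comNzRingType) (i : R) p m :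
  i ^+ 2 = -1 -> i ^+ m = 1 ->
  modeq (p%:R ^+ 3) (4%:R * powerSum i p m.+2)
    (p%:R ^+ 2 * (2%:R * i * 'C(m.+2, 2)%:R * powerSum i p m)).
Proof.
move=> i2 im.
have m_even : (-1) ^+ m = 1 :> R by rewrite -i2 exprAC im expr1n.
have [w quarter] := modeq_powerSum_affine i i 1 p m.
have [v half] := modeq_powerSum_affine i (-1) (1 + i) p m.
move: quarter half.
rewrite -powerSum_quarter_turn // -powerSum_half_turn.
rewrite !exprS im m_even => /eqP + /eqP.
rewrite -subr_eq0 => /eqP quarter; rewrite -subr_eq0 => /eqP half.
exists (2%:R * w + (1 + i) * v); apply/eqP; rewrite -subr_eq0; apply/eqP.
(* The multipliers 2 and [1 + i] cancel the terms in [powerSum i p m.+1],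
   since [(1 + i) ^ 2 = 2 i]. *)
rewrite -[RHS]addr0 -{1}(mulr0 2%:R) -{1}quarter -(mulr0 (1 + i)) -{1}half.
ring: i2.
Qed.

(** The binomial theorem separates the variables [a] and [b]: the coefficient of
    [i ^ k] is [C(m,k) * S (m-k) * S k], with [S] the power sums of [1, .., p-1].
    If [p-1] divided both [k] and [m-k] it would divide [m]; so [p] divides one
    of the two factors. *)
Lemma powerSum_dvd (R : comNzRingType) (i : R) p m :
  prime p -> ~~ (p.-1 %| m)%N -> modeq p%:R (powerSum i p m) 0.
Proof.
move=> p_pr ndvd.
pose S k := (\sum_(1 <= a < p) a ^ k)%N.
have -> : powerSum i p m =
    \sum_(0 <= k < m.+1) (S (m - k)%N * S k)%:R * (i ^+ k *+ 'C(m, k)).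
  transitivity (\sum_(1 <= a < p) \sum_(0 <= k < m.+1) \sum_(1 <= b < p)
      (a ^ (m - k) * b ^ k)%:R * (i ^+ k *+ 'C(m, k))).
    apply: eq_bigr => a _; rewrite exchange_big /=; apply: eq_bigr => b _.
    rewrite exprDn big_mkord; apply: eq_bigr => k _.
    by rewrite exprMn natrM !natrX mulrnAr !mulrA.
  rewrite exchange_big /=; apply: eq_bigr => k _.
  rewrite big_distrl natr_sum mulr_suml; apply: eq_bigr => a _.
  by rewrite big_distrr natr_sum mulr_suml.
have sum0 : \sum_(0 <= k < m.+1) 0 = 0 :> R by rewrite big1.
rewrite -[X in modeq _ _ X]sum0.
apply: modeq_sum => k /andP[_]; rewrite ltnS => k_le.
have [c ->] : exists c, (S (m - k) * S k = c * p)%N.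
  apply/dvdnP; have [pk|pk] := boolP (p.-1 %| k)%N; last first.
    by rewrite dvdn_mull // dvdn_sum_expn.
  rewrite dvdn_mulr // dvdn_sum_expn //.
  by apply: contra ndvd => pmk; rewrite -(subnK k_le) dvdn_add.
by exists (c%:R * (i ^+ k *+ 'C(m, k))); rewrite natrM; ring.
Qed.

(** * Valuations of Gaussian integers *)

Lemma gauss_natmul (d : nat) (z : gaussInt) :
  d%:R * z = Complex (d%:Z * complex.Re z) (d%:Z * complex.Im z).
Proof.
have -> : d%:R = Complex d%:Z 0 :> gaussInt.
  by have := gaussIntE d 0; rewrite mul0r addr0.
case: z => x y.
by rewrite -[LHS]/(ComplexField.mulc _ _) /= !mul0r subr0 addr0.
Qed.

Lemma le_vpint (p k : nat) (m : int) : prime p -> (p ^ k %| `|m|)%N ->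
  (k%:Z%:E <= vpint p m)%E.
Proof.
move=> p_pr; rewrite /vpint; case: eqP => [_ _|/eqP m0]; first exact: leey.
by rewrite pfactor_dvdn ?absz_gt0 // lee_fin.
Qed.

(** Multiplication by a natural number acts on the real and imaginary parts
    separately, so a factor [c] prime to [p] can be removed in each of them. *)
Lemma le_vpgauss (p k c : nat) (z : gaussInt) : prime p -> coprime p c ->
  modeq (p%:R ^+ k) (c%:R * z) 0 -> (k%:Z%:E <= vpgauss p z)%E.
Proof.
move=> p_pr co [w].
rewrite add0r -natrX !gauss_natmul => -[zre zim].
have dvd_part (x y : int) : c%:Z * x = (p ^ k)%N%:Z * y -> (p ^ k %| `|x|)%N.
  move=> /(congr1 absz); rewrite !abszM !absz_nat => cx_eq.
  by rewrite -(@Gauss_dvdr _ c) ?coprimeXl // cx_eq dvdn_mulr.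
by rewrite le_min !le_vpint //; [exact: dvd_part zim | exact: dvd_part zre].
Qed.

Lemma eqn_mod_addl2 (m d : nat) : (m.+2 == 2 %[mod d])%N = (d %| m)%N.
Proof. by have := eqn_modDr 2 m 0 d; rewrite (addn2 m) add0n mod0n. Qed.

Theorem theorem5 (p n : nat) (p_prime : prime p) (p_ge5 : (5 <= p)%N)
    (n_ge1 : (1 <= n)%N) (n_mod4 : (n = 2 %[mod 4])%N) :
  (2%:Z%:E <= vpgauss p (gaussPowerSum n p))%E /\
  (~ (n = 2 %[mod p.-1])%N -> (3%:Z%:E <= vpgauss p (gaussPowerSum n p))%E).
Proof.
have [m n_eq m_mod4] : exists2 m, n = m.+2 & (4 %| m)%N.
  case: n n_ge1 n_mod4 => [//|[//|m]] _ /eqP.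
  by rewrite eqn_mod_addl2; exists m.
have co4 : coprime p 4 by rewrite prime_coprime // gtnNdvd.
have im : gaussI ^+ m = 1.
  by have /dvdnP[c ->] := m_mod4; rewrite mulnC exprM (exprM _ 2 2)
    sqr_gaussI sqrrN !expr1n.
have [w rot] := powerSum_rotation p sqr_gaussI im.
rewrite -[gaussPowerSum n p]/(powerSum gaussI p n) n_eq.
split=> [|ndvd]; apply: (le_vpgauss p_prime co4); rewrite rot.
  exists (2%:R * gaussI * 'C(m.+2, 2)%:R * powerSum gaussI p m + p%:R * w).
  by ring.
have [|v ->] := powerSum_dvd gaussI p_prime (m := m).
  apply/negP => pm; apply: ndvd; apply/eqP.
  by rewrite eqn_mod_addl2.
by exists (2%:R * gaussI * 'C(m.+2, 2)%:R * v + w); ring.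
Qed.
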